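(* Assume $N\ge2$ and that conditions A, D' and E' hold for the semi-Markov processes $\eta^{(\varepsilon)}(t)$, $\varepsilon\in(0,\varepsilon_0]$, together with the paper's standing regularity conditions on the semi-Markov kernels, and let $\delta^*=\min_{i\in\mathbb{X},\,j\in\mathbb{Y}_i}(\delta_{ij}\wedge\dot\delta_{ij})$. Then for every $r\in\mathbb{X}$ the reduced semi-Markov processes ${}_r\eta^{(\varepsilon)}(t)$ satisfy conditions A and D' (with transition probabilities ${}_rp_{ij}$ and sets ${}_r\mathbb{Y}_i$, same $\varepsilon_0$) and the same standing regularity conditions, and they satisfy condition E': for every $i\in{}_r\mathbb{X}$, $j\in{}_r\mathbb{Y}_i$ there are integers ${}_rm^-_{ij}\le{}_rm^+_{ij}$, reals ${}_rb_{ij}[l]$ with ${}_rb_{ij}[{}_rm^-_{ij}]>0$, and ${}_r\dot\delta_{ij}\in(0,1]$, ${}_r\dot G_{ij}\in(0,\infty)$, ${}_r\dot\varepsilon_{ij}\in(0,\varepsilon_0]$ such that $\big|{}_re_{ij}(\varepsilon)-\sum_{l={}_rm^-_{ij}}^{{}_rm^+_{ij}}{}_rb_{ij}[l]\varepsilon^l\big|\le{}_r\dot G_{ij}\varepsilon^{{}_rm^+_{ij}+{}_r\dot\delta_{ij}}$ for $0<\varepsilon\le{}_r\dot\varepsilon_{ij}$. Moreover this holds with ${}_r\dot\delta_{ij}\ge\delta^*$ for all $j\in{}_r\mathbb{Y}_i$, $i\in{}_r\mathbb{X}$, $r\in\mathbb{X}$.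
   Context: Let $\mathbb{X}=\{1,\dots,N\}$, $0<\varepsilon_0\le1$. For each $\varepsilon\in(0,\varepsilon_0]$, $\eta^{(\varepsilon)}(t)$ is a semi-Markov process on $\mathbb{X}$ with semi-Markov transition probabilities $Q^{(\varepsilon)}_{ij}(t)$; $p_{ij}(\varepsilon)=Q^{(\varepsilon)}_{ij}(\infty)$ are the transition probabilities of the embedded Markov chain and $e_{ij}(\varepsilon)=\int_0^\infty t\,Q^{(\varepsilon)}_{ij}(dt)$ the (finite) expectations of sojourn times. The paper also assumes standing regularity conditions on $Q^{(\varepsilon)}_{ij}$ guaranteeing a well-defined process with finite $e_{ij}(\varepsilon)$; the claim concerns only $p_{ij}$ and $e_{ij}$. Condition A: there are nonempty $\mathbb{Y}_i\subseteq\mathbb{X}$ with (a) $p_{ij}(\varepsilon)>0$ for $j\in\mathbb{Y}_i$; (b) $p_{ij}(\varepsilon)=0$ (hence $e_{ij}(\varepsilon)=0$) for $j\notin\mathbb{Y}_i$; (c) for all $i,j$ there are $n\ge1$ and $i=l_0,\dots,l_n=j$ with $l_m\in\mathbb{Y}_{l_{m-1}}$. Condition D': for $j\in\mathbb{Y}_i$, $p_{ij}(\varepsilon)=\sum_{l=l^-_{ij}}^{l^+_{ij}}a_{ij}[l]\varepsilon^l+o_{ij}(\varepsilon)$ with integers $0\le l^-_{ij}\le l^+_{ij}$, $a_{ij}[l^-_{ij}]>0$, $|o_{ij}(\varepsilon)|\le G_{ij}\varepsilon^{l^+_{ij}+\delta_{ij}}$ for $0<\varepsilon\le\varepsilon_{ij}$,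 $\delta_{ij}\in(0,1]$, $G_{ij}\in(0,\infty)$, $\varepsilon_{ij}\in(0,\varepsilon_0]$. Condition E': for $j\in\mathbb{Y}_i$, $e_{ij}(\varepsilon)=\sum_{l=m^-_{ij}}^{m^+_{ij}}b_{ij}[l]\varepsilon^l+\dot o_{ij}(\varepsilon)$ with integers $m^-_{ij}\le m^+_{ij}$, $b_{ij}[m^-_{ij}]>0$, $|\dot o_{ij}(\varepsilon)|\le\dot G_{ij}\varepsilon^{m^+_{ij}+\dot\delta_{ij}}$ for $0<\varepsilon\le\dot\varepsilon_{ij}$, $\dot\delta_{ij}\in(0,1]$, $\dot G_{ij}\in(0,\infty)$, $\dot\varepsilon_{ij}\in(0,\varepsilon_0]$. Reduced process: for $r\in\mathbb{X}$, ${}_r\eta^{(\varepsilon)}(t)$ is the semi-Markov process on ${}_r\mathbb{X}=\mathbb{X}\setminus\{r\}$ obtained by observing $\eta^{(\varepsilon)}$ only at jump times into ${}_r\mathbb{X}$ (excursions through $r$ are absorbed into sojourn times); its embedded transition probabilities are ${}_rp_{ij}=p_{ij}+p_{ir}\frac{p_{rj}}{1-p_{rr}}$ and its sojourn expectations are ${}_re_{ij}=e_{ij}+e_{ir}\frac{p_{rj}}{1-p_{rr}}+e_{rr}\frac{p_{ir}}{1-p_{rr}}\frac{p_{rj}}{1-p_{rr}}+e_{rj}\frac{p_{ir}}{1-p_{rr}}$ (all functions of $\varepsilon$), $i,j\in{}_r\mathbb{X}$; its transition sets are ${}_r\mathbb{Y}_i=\{j\in{}_r\mathbb{X}: j\in\mathbb{Y}_i\text{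 or }(r\in\mathbb{Y}_i\text{ and }j\in\mathbb{Y}_r)\}$. *)

(* Defs.v *)
From HB Require Import structures.
From mathcomp Require Import all_boot all_order all_algebra.
From mathcomp Require Import all_classical all_reals all_analysis.
Set Implicit Arguments. Unset Strict Implicit. Unset Printing Implicit Defensive.
Import Order.TTheory GRing.Theory Num.Theory.
Local Open Scope ring_scope.

Section Defs.
Variable R : realType.

(* A perturbed semi-Markov process on a finite state space T is represented by
   its embedded transition probabilities p i j eps and the expectations of the
   sojourn times e i j eps (the claim concerns only these). *)

(* Standing regularity (the part expressible in terms of p and e):
   p(eps) is a stochastic matrix and the e_ij(eps) are (finite) nonnegative. *)
Definition semiMarkov_pe (T : finType) (eps0 : R)
    (p e : T -> T -> R -> R) : Prop :=
  forall eps, 0 < eps <= eps0 ->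
    (forall i j, 0 <= p i j eps) /\
    (forall i, \sum_(j : T) p i j eps = 1) /\
    (forall i j, 0 <= e i j eps).

Definition condA (T : finType) (eps0 : R) (p e : T -> T -> R -> R)
    (Y : T -> {set T}) : Prop :=
  (forall i, [exists j, j \in Y i]) /\
  (forall eps, 0 < eps <= eps0 ->
     (forall i j, j \in Y i -> 0 < p i j eps) /\
     (forall i j, j \notin Y i -> p i j eps = 0 /\ e i j eps = 0)) /\
  (forall i j, exists (n : nat) (l : nat -> T),
     [/\ (0 < n)%N, l 0%N = i, l n = j &
         forall m, (0 < m <= n)%N -> l m \in Y (l m.-1)]).

Definition expD (eps0 : R) (f : R -> R) (lm lp : nat) (a : nat -> R)
    (d G eps1 : R) : Prop :=
  [/\ (lm <= lp)%N, 0 < a lm, 0 < d <= 1, (0 < G) /\ (0 < eps1 <= eps0) &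
      forall eps, 0 < eps <= eps1 ->
        `| f eps - \sum_(lm <= l < lp.+1) a l * eps ^+ l |
          <= G * eps `^ (lp%:R + d)].

(* Expansion of type E': integer exponents mm <= mp (possibly negative);
   the sum runs over l = mm, mm+1, ..., mp. *)
Definition expE (eps0 : R) (f : R -> R) (mm mp : int) (b : int -> R)
    (d G eps1 : R) : Prop :=
  [/\ mm <= mp, 0 < b mm, 0 < d <= 1, (0 < G) /\ (0 < eps1 <= eps0) &
      forall eps, 0 < eps <= eps1 ->
        `| f eps - \sum_(k < (absz (mp - mm)).+1)
                     b (mm + k%:Z) * eps ^ (mm + k%:Z) |
          <= G * eps `^ (mp%:~R + d)].

Definition condD (T : finType) (eps0 : R) (p : T -> T -> R -> R)
    (Y : T -> {set T}) : Prop :=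
  forall i j, j \in Y i ->
    exists (lm lp : nat) (a : nat -> R) (d G eps1 : R),
      expD eps0 (p i j) lm lp a d G eps1.

Definition condE_ge (T : finType) (eps0 : R) (e : T -> T -> R -> R)
    (Y : T -> {set T}) (dlow : R) : Prop :=
  forall i j, j \in Y i ->
    exists (mm mp : int) (b : int -> R) (d G eps1 : R),
      expE eps0 (e i j) mm mp b d G eps1 /\ dlow <= d.

Definition rX (N : nat) (r : 'I_N) : finType := {i : 'I_N | i != r}.

Definition rp (N : nat) (r : 'I_N) (p : 'I_N -> 'I_N -> R -> R)
    (i j : rX r) (eps : R) : R :=
  p (val i) (val j) eps + p (val i) r eps * (p r (val j) eps / (1 - p r r eps)).

Definition re (N : nat) (r : 'I_N) (p e : 'I_N -> 'I_N -> R -> R)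
    (i j : rX r) (eps : R) : R :=
  e (val i) (val j) eps
  + e (val i) r eps * (p r (val j) eps / (1 - p r r eps))
  + e r r eps * (p (val i) r eps / (1 - p r r eps))
              * (p r (val j) eps / (1 - p r r eps))
  + e r (val j) eps * (p (val i) r eps / (1 - p r r eps)).

Definition rY (N : nat) (r : 'I_N) (Y : 'I_N -> {set 'I_N}) (i : rX r)
    : {set rX r} :=
  [set j : rX r | (val j \in Y (val i)) || ((r \in Y (val i)) && (val j \in Y r))].

(* delta^* = min over i in X, j in Y_i of (delta_ij /\ delta-dot_ij).
   (All these are in (0,1], and the Y_i are nonempty, so 1 is a neutral start.) *)
Definition deltastar (N : nat) (Y : 'I_N -> {set 'I_N}) (dl dd : 'I_N -> 'I_N -> R)
    : R :=
  \big[Num.min/1]_(i : 'I_N) \big[Num.min/1]_(j in Y i) Num.min (dl i j) (dd i j).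

End Defs.

Arguments rp {R N} r p i j eps.
Arguments re {R N} r p e i j eps.
Arguments rY {N} r Y i.

(* Main.v *)
(* For [j \in Y_i], [p_ij] and [e_ij] have a positive leading term: they are
   [c eps^m + O(eps^(m + d))] with [c > 0], for every [d] in (0,1] below all
   the remainder exponents, e.g. [d = delta^*].  Such functions, together with
   the functions vanishing on (0,eps0], are closed under sums and products, and
   positive leading terms survive inversion.  Irreducibility gives some
   [j != r] in [Y_r], so [1 - p_rr = \sum_(j != r) p_rj] has a positive
   leading term, and therefore so do the reduced [rp_ij] and [re_ij] for
   [j \in rY_i]; a leading term is a one-term expansion with remainder
   exponent [d], and its exponent is nonnegative for [rp_ij <= 1].  The reduced
   chain is irreducible since a path of the original chain, with its visits to
   [r] skipped, is a path of the reduced one. *)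
From HB Require Import structures.
From mathcomp Require Import all_boot all_order all_algebra.
From mathcomp Require Import all_classical all_reals all_analysis.
From mathcomp Require Import ring lra zify.
Require Import Defs.
Set Implicit Arguments. Unset Strict Implicit. Unset Printing Implicit Defensive.
Import Order.TTheory GRing.Theory Num.Theory.
Local Open Scope ring_scope.

Definition reach (T : Type) (step : T -> T -> Prop) (x y : T) : Prop :=
  exists (n : nat) (l : nat -> T),
    [/\ (0 < n)%N, l 0%N = x, l n = y &
        forall m, (0 < m <= n)%N -> step (l m.-1) (l m)].

Section Reach.
Variables (T : Type) (step : T -> T -> Prop).

Lemma reach_step x y : step x y -> reach step x y.
Proof.
by move=> h; exists 1%N, (fun m => if m is 0%N then x else y); split=> // -[|[]].
Qed.

Lemma reach_trans x y z : reach step x y -> reach step y z -> reach step x z.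
Proof.
move=> [n1 [l1 [n10 l10 l1n H1]]] [n2 [l2 [n20 l20 l2n H2]]].
exists (n1 + n2)%N, (fun m => if (m <= n1)%N then l1 m else l2 (m - n1)%N); split.
- by rewrite addn_gt0 n10.
- by rewrite leq0n.
- by rewrite leqNgt -{1}(addn0 n1) ltn_add2l n20 addKn.
move=> m /andP[m0 mn]; case: (leqP m n1) => hm.
  by rewrite (leq_trans (leq_pred m) hm); apply: H1; rewrite m0.
case: (leqP m.-1 n1) => hm'.
  have -> : m.-1 = n1 by lia.
  have -> : (m - n1 = 1)%N by lia.
  by rewrite l1n -l20; apply: (H2 1%N); rewrite n20.
have -> : (m.-1 - n1 = (m - n1).-1)%N by lia.
by apply: (H2 (m - n1)%N); lia.
Qed.

End Reach.

Lemma exists_exit (T : eqType) (l : nat -> T) (x : T) n :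
  l 0%N = x -> l n != x -> exists m, [/\ (0 < m <= n)%N, l m.-1 = x & l m != x].
Proof.
move=> l0; elim: n => [|n IH] ln; first by rewrite l0 eqxx in ln.
case: (eqVneq (l n) x) => hn; first by exists n.+1; rewrite ltn0Sn leqnn.
by have [m [/andP[m0 mn] *]] := IH hn; exists m; rewrite m0 (leq_trans mn).
Qed.

Lemma sum_rX (R : nmodType) (N : nat) (r : 'I_N) (F : 'I_N -> R) :
  \sum_(j : rX r) F (val j) = \sum_(k | k != r) F k.
Proof. by rewrite -big_sub. Qed.

Section ReducedReach.
Variables (N : nat) (Y : 'I_N -> {set 'I_N}) (r : 'I_N).
Hypothesis Y_irr : forall i j, reach (fun u v => v \in Y u) i j.

Lemma exists_exit_r : (2 <= N)%N -> exists2 k, k != r & k \in Y r.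
Proof.
move=> N2; have /card_gt0P[w] : (0 < #|predC1 r|)%N by rewrite cardC1 card_ord; lia.
rewrite !inE => wr; have [n [l [_ l0 ln Hl]]] := Y_irr r w.
have lnr : l n != r by rewrite ln.
have [m [m0 lm lm']] := exists_exit l0 lnr.
by exists (l m); rewrite // -lm Hl.
Qed.

Lemma mem_rY (u v : rX r) w : w \in Y (val u) ->
  val v = w \/ (w = r /\ val v \in Y r) -> v \in rY r Y u.
Proof.
rewrite inE => hw [->|[wr hv]]; first by rewrite hw.
by move: hw; rewrite wr => ->; rewrite hv orbT.
Qed.

(* Invariant along a path from [x]: the current state, or every exit state of
   [r] when the path sits at [r], is reachable from [x] in the reduced chain. *)
Lemma reach_rY (x y : rX r) : reach (fun u v : rX r => v \in rY r Y u) x y.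
Proof.
have [n [l [n0 l0 ln Hl]]] := Y_irr (val x) (val y).
suff inv m : (0 < m <= n)%N -> forall v : rX r,
    val v = l m \/ (l m = r /\ val v \in Y r) ->
    reach (fun u v : rX r => v \in rY r Y u) x v.
  by apply: (inv n); rewrite ?n0 ?leqnn //; left.
elim: m => // m IH /andP[_ mn] v hv; have hm := Hl m.+1 mn.
case: m IH mn hm hv => [|m] IH mn hm hv.
  by apply/reach_step/(mem_rY _ hv); rewrite -l0.
have {}IH := IH (ltnW mn).
case: (eqVneq (l m.+1) r) => lr.
  by apply: IH; right; split=> //; case: hv => [->|[_ //]]; rewrite -lr.
pose u : rX r := exist _ (l m.+1) lr.
apply: reach_trans (IH u (or_introl erefl)) _.
exact/reach_step/(@mem_rY u v _ hm hv).
Qed.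

End ReducedReach.

Lemma powRD_gt0 (R : realType) (e x y : R) : 0 < e -> e `^ (x + y) = e `^ x * e `^ y.
Proof. by move=> e0; rewrite powRD // (gt_eqF e0) implybT. Qed.

Section LeadingTerm.
Variables (R : realType) (eps0 d : R).
Hypotheses (eps0P : 0 < eps0 <= 1) (dP : 0 < d <= 1).

Definition lead_exp (f : R -> R) (m : int) (c : R) : Prop :=
  0 < c /\ exists G e1, [/\ 0 < G, 0 < e1 <= eps0 & forall eps, 0 < eps <= e1 ->
    `|f eps - c * eps `^ m%:~R| <= G * eps `^ (m%:~R + d)].

Definition has_lead (f : R -> R) : Prop := exists m c, lead_exp f m c.

Definition vanishes (f : R -> R) : Prop := forall eps, 0 < eps <= eps0 -> f eps = 0.

Definition has_lead0 (f : R -> R) : Prop := vanishes f \/ has_lead f.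

Lemma in_eps0 eps e1 : 0 < eps <= e1 -> e1 <= eps0 -> 0 < eps <= eps0.
Proof. by move=> /andP[-> h1] h2; rewrite (le_trans h1 h2). Qed.

Lemma in_eps01 eps e1 : 0 < eps <= e1 -> e1 <= eps0 -> 0 < eps <= 1.
Proof.
by move=> he /(in_eps0 he)/andP[-> h]; rewrite (le_trans h) //; case/andP: eps0P.
Qed.

Lemma powR_d_le1 eps : 0 < eps <= 1 -> eps `^ d <= 1.
Proof. by move=> he; rewrite -(powRr0 eps) ger_powR //; case/andP: dP => /ltW. Qed.

Lemma mul_powR_d_small G c : 0 < G -> 0 < c ->
  exists e2, 0 < e2 <= eps0 /\ forall eps, 0 < eps <= e2 -> G * eps `^ d <= c.
Proof.
move=> G0 c0; case/andP: eps0P => e00 e01; case/andP: dP => d0 d1.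
exists (Num.min eps0 ((c / G) `^ d^-1)); split.
  by rewrite lt_min e00 powR_gt0 ?divr_gt0 // ge_min lexx.
move=> eps /andP[ep0]; rewrite le_min => /andP[_ h].
have : eps `^ d <= ((c / G) `^ d^-1) `^ d.
  by apply: ge0_ler_powR; rewrite ?nnegrE ?powR_ge0 // ltW.
rewrite -powRrM mulVf ?gt_eqF // powRr1; last by rewrite divr_ge0 // ltW.
by move=> h2; rewrite mulrC -ler_pdivlMr.
Qed.

Lemma lead_exp_ext f g m c : (forall eps, 0 < eps <= eps0 -> f eps = g eps) ->
  lead_exp f m c -> lead_exp g m c.
Proof.
move=> fg [c0 [G [e1 [G0 he1 H]]]]; split=> //; exists G, e1; split=> // eps he.
by rewrite -fg ?H // (in_eps0 he) //; case/andP: he1.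
Qed.

Lemma lead_exp_add_lt f g m n a b : m < n -> lead_exp f m a -> lead_exp g n b ->
  lead_exp (fun eps => f eps + g eps) m a.
Proof.
move=> mn [a0 [G1 [e1 [G10 /andP[e10 e1e0] H1]]]] [b0 [G2 [e2 [G20 /andP[e20 e2e0] H2]]]].
split=> //; exists (G1 + G2 + b), (Num.min e1 e2); split.
- by rewrite !addr_gt0.
- by rewrite lt_min e10 e20 ge_min e1e0.
move=> eps /andP[ep0]; rewrite le_min => /andP[h1 h2].
have he1 : 0 < eps <= e1 by rewrite ep0.
have he2 : 0 < eps <= e2 by rewrite ep0.
have ep1 := in_eps01 he1 e1e0.
have mdn : m%:~R + d <= (n%:~R : R).
  rewrite -lezD1 -(ler_int R) intrD in mn; apply: le_trans mn.
  by rewrite lerD2l; case/andP: dP.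
have k1 : eps `^ (n%:~R + d) <= eps `^ (m%:~R + d).
  by rewrite ger_powR // (le_trans mdn) // lerDl; case/andP: dP => /ltW.
have k2 : eps `^ (n%:~R) <= eps `^ (m%:~R + d) by rewrite ger_powR.
have k3 : G2 * eps `^ (n%:~R + d) <= G2 * eps `^ (m%:~R + d) by rewrite ler_pM2l.
have k4 : b * eps `^ (n%:~R) <= b * eps `^ (m%:~R + d) by rewrite ler_pM2l.
have := powR_ge0 eps (m%:~R + d); have := powR_ge0 eps n%:~R.
move: (H1 _ he1) (H2 _ he2); rewrite !ler_norml => /andP[u1 u2] /andP[v1 v2].
move=> *; apply/andP; split; nra.
Qed.

Lemma lead_exp_add f g m a b : lead_exp f m a -> lead_exp g m b ->
  lead_exp (fun eps => f eps + g eps) m (a + b).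
Proof.
move=> [a0 [G1 [e1 [G10 /andP[e10 e1e0] H1]]]] [b0 [G2 [e2 [G20 /andP[e20 e2e0] H2]]]].
split; first by rewrite addr_gt0.
exists (G1 + G2), (Num.min e1 e2); split.
- by rewrite !addr_gt0.
- by rewrite lt_min e10 e20 ge_min e1e0.
move=> eps /andP[ep0]; rewrite le_min => /andP[h1 h2].
have he1 : 0 < eps <= e1 by rewrite ep0.
have he2 : 0 < eps <= e2 by rewrite ep0.
move: (H1 _ he1) (H2 _ he2); rewrite !ler_norml => /andP[u1 u2] /andP[v1 v2].
apply/andP; split; nra.
Qed.

Lemma lead_exp_mul f g m n a b : lead_exp f m a -> lead_exp g n b ->
  lead_exp (fun eps => f eps * g eps) (m + n) (a * b).
Proof.
move=> [a0 [G1 [e1 [G10 /andP[e10 e1e0] H1]]]] [b0 [G2 [e2 [G20 /andP[e20 e2e0] H2]]]].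
split; first by rewrite mulr_gt0.
exists (G1 * G2 + a * G2 + b * G1), (Num.min e1 e2); split.
- by rewrite !addr_gt0 ?mulr_gt0.
- by rewrite lt_min e10 e20 ge_min e1e0.
move=> eps /andP[ep0]; rewrite le_min => /andP[h1 h2].
have he1 : 0 < eps <= e1 by rewrite ep0.
have he2 : 0 < eps <= e2 by rewrite ep0.
have D1 := powR_d_le1 (in_eps01 he1 e1e0).
move: (H1 _ he1) (H2 _ he2); rewrite intrD !powRD_gt0 //.
have := powR_gt0 (m%:~R) ep0; have := powR_gt0 (n%:~R) ep0; have := powR_gt0 d ep0.
move: D1; set A := eps `^ m%:~R; set B := eps `^ n%:~R; set D := eps `^ d.
move=> D1 D0 B0 A0 hu hv.
set u := f eps - a * A in hu; set v := g eps - b * B in hv.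
have -> : f eps * g eps - a * b * (A * B) = u * v + (a * A) * v + (b * B) * u.
  by rewrite /u /v; ring.
apply: le_trans (ler_normD _ _) _; apply: le_trans (lerD (ler_normD _ _) (lexx _)) _.
rewrite !normrM (gtr0_norm a0) (gtr0_norm b0) (gtr0_norm A0) (gtr0_norm B0).
have k1 : `|u| * `|v| <= (G1 * (A * D)) * (G2 * (B * D)) by apply: ler_pM.
have k2 : (G1 * (A * D)) * (G2 * (B * D)) <= G1 * G2 * (A * B * D).
  have -> : (G1 * (A * D)) * (G2 * (B * D)) = (G1 * G2 * (A * B * D)) * D by ring.
  by apply: ler_piMr => //; rewrite !mulr_ge0 ?ltW.
have k3 : a * A * `|v| <= a * A * (G2 * (B * D)) by rewrite ler_pM2l ?mulr_gt0.
have k4 : b * B * `|u| <= b * B * (G1 * (A * D)) by rewrite ler_pM2l ?mulr_gt0.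
lra.
Qed.

Lemma lead_exp_inv g n b : lead_exp g n b -> lead_exp (fun eps => (g eps)^-1) (- n) b^-1.
Proof.
move=> [b0 [G [e1 [G0 /andP[e10 e1e0] H]]]].
have [e2 [/andP[e20 e2e0] He2]] := mul_powR_d_small G0 (divr_gt0 b0 (ltr0Sn R 1)).
split; first by rewrite invr_gt0.
exists (2 * G / b ^+ 2), (Num.min e1 e2); split.
- by rewrite divr_gt0 ?mulr_gt0 ?exprn_gt0.
- by rewrite lt_min e10 e20 ge_min e1e0.
move=> eps /andP[ep0]; rewrite le_min => /andP[h1 h2].
have he1 : 0 < eps <= e1 by rewrite ep0.
have he2 : 0 < eps <= e2 by rewrite ep0.
rewrite intrN (addrC (- _)) powRD_gt0 // powRN.
move: (H _ he1) (He2 _ he2); rewrite powRD_gt0 //.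
have := powR_gt0 (n%:~R) ep0; have := powR_gt0 d ep0.
set B := eps `^ n%:~R; set D := eps `^ d; set x := g eps.
move=> D0 B0 hx hD.
(* For small [eps] the remainder is at most half the leading term, so [x >= b B / 2]. *)
have xlow : b * B / 2 <= x.
  move: hx; rewrite ler_norml => /andP[u1 u2].
  have : G * D * B <= b / 2 * B by rewrite ler_pM2r.
  lra.
have x0 : 0 < x by apply: lt_le_trans xlow; rewrite !mulr_gt0 ?invr_gt0.
have -> : x^-1 - b^-1 * B^-1 = (b * B - x) / (x * (b * B)).
  by field; rewrite !gt_eqF.
rewrite normrM [`|(_ * _)^-1|]gtr0_norm ?invr_gt0 ?mulr_gt0 // distrC.
rewrite ler_pdivrMr ?mulr_gt0 //; apply: le_trans hx _.
have -> : 2 * G / b ^+ 2 * (D * B^-1) * (x * (b * B)) = (G * D) * (2 * x / b).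
  by field; rewrite !gt_eqF.
have hB : B <= 2 * x / b by rewrite ler_pdivlMr //; lra.
have : G * D * B <= G * D * (2 * x / b) by rewrite ler_pM2l ?mulr_gt0.
lra.
Qed.

Lemma lead_exp_exponent_ge0 f m c : lead_exp f m c ->
  (forall eps, 0 < eps <= eps0 -> f eps <= 1) -> 0 <= m.
Proof.
move=> [c0 [G [e1 [G0 /andP[e10 e1e0] H]]]] f_le1.
rewrite leNgt; apply/negP => m0.
have [e2 [/andP[e20 e2e0] He2]] := mul_powR_d_small G0 (divr_gt0 c0 (ltr0Sn R 1)).
(* At [eps = min(e1, e2, c/4)], [f eps >= c eps^m / 2 >= c / (2 eps) >= 2]. *)
pose eps := Num.min (Num.min e1 e2) (c / 4).
have ep0 : 0 < eps by rewrite !lt_min e10 e20 divr_gt0.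
have : eps <= Num.min e1 e2 by rewrite ge_min lexx.
rewrite le_min => /andP[h1 h2].
have h3 : eps <= c / 4 by rewrite ge_min lexx orbT.
have he1 : 0 < eps <= e1 by rewrite ep0.
have he2 : 0 < eps <= e2 by rewrite ep0.
have hA : eps^-1 <= eps `^ m%:~R.
  rewrite -(powR_inv1 (ltW ep0)) ger_powR ?(in_eps01 he1) //.
  have : ((m + 1)%:~R : R) <= 0%:~R by rewrite ler_int lezD1.
  by rewrite intrD /= => h; lra.
move: (H _ he1) (He2 _ he2) (f_le1 _ (in_eps0 he1 e1e0)) hA; rewrite powRD_gt0 //.
have := powR_gt0 (m%:~R) ep0; have := powR_gt0 d ep0.
set A := eps `^ m%:~R; set D := eps `^ d.
move=> D0 A0; rewrite ler_norml => /andP[u1 u2] hD hf hA.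
have k1 : G * D * A <= c / 2 * A by rewrite ler_pM2r.
have k2 : 1 <= A * eps by rewrite -(mulVf (negbT (gt_eqF ep0))) ler_pM2r.
have k3 : c / 2 * A * eps <= eps by rewrite -[X in _ <= X]mul1r ler_pM2r; lra.
have k4 : c / 2 <= c / 2 * A * eps.
  by rewrite -mulrA -[X in X <= _]mulr1 ler_pM2l // divr_gt0.
lra.
Qed.

Lemma has_lead_ext f g : (forall eps, 0 < eps <= eps0 -> f eps = g eps) ->
  has_lead f -> has_lead g.
Proof. by move=> fg [m [c h]]; exists m, c; apply: lead_exp_ext h. Qed.

Lemma has_lead0_ext f g : (forall eps, 0 < eps <= eps0 -> f eps = g eps) ->
  has_lead0 f -> has_lead0 g.
Proof.
move=> fg [h|h]; last by right; apply: has_lead_ext h.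
by left=> eps he; rewrite -fg // h.
Qed.

Lemma has_leadD f g : has_lead f -> has_lead g -> has_lead (fun eps => f eps + g eps).
Proof.
move=> [m [a hf]] [n [b hg]]; case: (ltgtP m n) => [mn|nm|mn].
- by exists m, a; apply: lead_exp_add_lt hf hg.
- exists n, b; apply: (@lead_exp_ext (fun eps => g eps + f eps)).
    by move=> eps _; rewrite addrC.
  exact: lead_exp_add_lt hg hf.
- by exists m, (a + b); rewrite -mn in hg; apply: lead_exp_add.
Qed.

Lemma has_leadDl f g : has_lead f -> has_lead0 g -> has_lead (fun eps => f eps + g eps).
Proof.
move=> hf [hg|hg]; last exact: has_leadD.
by apply: has_lead_ext hf => eps /hg ->; rewrite addr0.
Qed.

Lemma has_leadDr f g : has_lead0 f -> has_lead g -> has_lead (fun eps => f eps + g eps).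
Proof.
by move=> hf /has_leadDl /(_ hf); apply: has_lead_ext => eps _; rewrite addrC.
Qed.

Lemma has_lead0D f g : has_lead0 f -> has_lead0 g -> has_lead0 (fun eps => f eps + g eps).
Proof.
move=> [hf|hf] hg; last by right; apply: has_leadDl.
case: hg => hg; last by right; apply: has_leadDr => //; left.
by left=> eps he; rewrite hf // hg // addr0.
Qed.

Lemma has_leadM f g : has_lead f -> has_lead g -> has_lead (fun eps => f eps * g eps).
Proof. by move=> [m [a hf]] [n [b hg]]; exists (m + n), (a * b); apply: lead_exp_mul. Qed.

Lemma has_lead0M f g : has_lead0 f -> has_lead0 g -> has_lead0 (fun eps => f eps * g eps).
Proof.
move=> [hf|hf]; first by left=> eps he; rewrite hf // mul0r.
move=> [hg|hg]; first by left=> eps he; rewrite hg // mulr0.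
by right; apply: has_leadM.
Qed.

Lemma has_leadV g : has_lead g -> has_lead (fun eps => (g eps)^-1).
Proof. by move=> [n [b hg]]; exists (- n), b^-1; apply: lead_exp_inv. Qed.

Lemma has_lead0_sum (I : Type) (s : seq I) (P : pred I) (F : I -> R -> R) :
  (forall k, has_lead0 (F k)) -> has_lead0 (fun eps => \sum_(k <- s | P k) F k eps).
Proof.
move=> hF; elim: s => [|x s IH]; first by left=> eps _; rewrite big_nil.
have [Px|nPx] := boolP (P x).
  apply: (@has_lead0_ext (fun eps => F x eps + \sum_(k <- s | P k) F k eps)).
    by move=> eps _; rewrite big_cons Px.
  exact: has_lead0D.
by apply: has_lead0_ext IH => eps _; rewrite big_cons (negbTE nPx).
Qed.

Lemma has_lead_of_expD f lm lp (a : nat -> R) dl G el : d <= dl ->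
  expD eps0 f lm lp a dl G el -> has_lead f.
Proof.
move=> ddl [lmp a0 /andP[dl0 dl1] [G0 /andP[el0 ele0]] H].
exists lm%:Z, (a lm); split=> //.
set C := \sum_(lm.+1 <= l < lp.+1) `|a l|.
have C0 : 0 <= C by apply: sumr_ge0.
exists (G + C + 1), el; split; first by rewrite ltr_wpDl // addr_ge0 // ltW.
  by rewrite el0.
move=> eps he; have ep1 := in_eps01 he ele0; have ep0 := ltW (andP he).1.
have {H} := H _ he; rewrite big_ltn ?ltnS //.
set S := \sum_(lm.+1 <= l < lp.+1) a l * eps ^+ l.
change ((Posz lm)%:~R : R) with (lm%:R : R); rewrite -(powR_mulrn _ ep0).
(* Higher-order terms are absorbed in the remainder: [eps^l <= eps^(lm + d)]. *)
have hS : `|S| <= C * eps `^ (lm%:R + d).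
  apply: le_trans (ler_norm_sum _ _ _) _.
  rewrite /C mulr_suml; apply: ler_sum_nat => l /andP[hl _].
  rewrite normrM ler_wpM2l // -(powR_mulrn _ ep0) ger0_norm ?powR_ge0 //.
  rewrite ger_powR // (le_trans _ (_ : (lm.+1)%:R <= _)) ?ler_nat //.
  by rewrite -natr1 lerD2l; case/andP: dP.
have hR : G * eps `^ (lp%:R + dl) <= G * eps `^ (lm%:R + d).
  by rewrite ler_pM2l // ger_powR // lerD // ler_nat.
have := powR_ge0 eps (lm%:R + d).
move: hS hR; set T := eps `^ (lm%:R + d); set U := eps `^ (lp%:R + dl).
rewrite !ler_norml => /andP[v1 v2] hR P0 /andP[u1 u2].
apply/andP; split; nra.
Qed.

Lemma has_lead_of_expE f mm mp (b : int -> R) dl G el : d <= dl ->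
  expE eps0 f mm mp b dl G el -> has_lead f.
Proof.
move=> ddl [lmp b0 /andP[dl0 dl1] [G0 /andP[el0 ele0]] H].
exists mm, (b mm); split=> //.
set n := absz (mp - mm).
set C := \sum_(i < n) `|b (mm + (lift ord0 i : nat)%:Z)|.
have C0 : 0 <= C by apply: sumr_ge0.
exists (G + C + 1), el; split; first by rewrite ltr_wpDl // addr_ge0 // ltW.
  by rewrite el0.
move=> eps he; have ep1 := in_eps01 he ele0; have ep0 := ltW (andP he).1.
have {H} := H _ he; rewrite big_ord_recl /= addr0 -(powR_intmul _ ep0).
set S := \sum_(i < n) _.
have hS : `|S| <= C * eps `^ (mm%:~R + d).
  apply: le_trans (ler_norm_sum _ _ _) _.
  rewrite /C mulr_suml; apply: ler_sum => i _.
  rewrite normrM ler_wpM2l // -(powR_intmul _ ep0) ger0_norm ?powR_ge0 //.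
  rewrite ger_powR // intrD lerD2l /bump leq0n add1n.
  change ((Posz i.+1)%:~R : R) with (i.+1%:R : R).
  by case/andP: dP => _ h; apply: le_trans h _; rewrite ler1n.
have hR : G * eps `^ (mp%:~R + dl) <= G * eps `^ (mm%:~R + d).
  by rewrite ler_pM2l // ger_powR // lerD // ler_int.
have := powR_ge0 eps (mm%:~R + d).
move: hS hR; set T := eps `^ (mm%:~R + d); set U := eps `^ (mp%:~R + dl).
rewrite !ler_norml => /andP[v1 v2] hR P0 /andP[u1 u2].
apply/andP; split; nra.
Qed.

Lemma expE_of_lead_exp f m c : lead_exp f m c ->
  exists G e1, expE eps0 f m m (fun _ => c) d G e1.
Proof.
move=> [c0 [G [e1 [G0 he1 H]]]]; exists G, e1; split=> // eps he.
by rewrite subrr big_ord1 addr0 -powR_intmul ?H // ltW // (andP he).1.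
Qed.

Lemma expD_of_lead_exp f (k : nat) c : lead_exp f k%:Z c ->
  exists G e1, expD eps0 f k k (fun _ => c) d G e1.
Proof.
move=> [c0 [G [e1 [G0 he1 H]]]]; exists G, e1; split=> // eps he.
by rewrite big_nat1 -powR_mulrn ?H // ltW // (andP he).1.
Qed.

Section Reduction.
Variables (N : nat) (p e : 'I_N -> 'I_N -> R -> R) (Y : 'I_N -> {set 'I_N}) (r : 'I_N).
Hypotheses (N2 : (2 <= N)%N) (hsm : semiMarkov_pe eps0 p e) (hA : condA eps0 p e Y).
Hypotheses (p_lead : forall i j, j \in Y i -> has_lead (p i j))
  (e_lead : forall i j, j \in Y i -> has_lead (e i j)).

Lemma p_gt0 eps i j : 0 < eps <= eps0 -> j \in Y i -> 0 < p i j eps.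
Proof. by move=> he; apply: ((hA.2.1 _ he).1). Qed.

Lemma pe_eq0 eps i j : 0 < eps <= eps0 -> j \notin Y i -> p i j eps = 0 /\ e i j eps = 0.
Proof. by move=> he; apply: ((hA.2.1 _ he).2). Qed.

Lemma p_lead0 i j : has_lead0 (p i j).
Proof.
have [h|h] := boolP (j \in Y i); first by right; apply: p_lead.
by left=> eps he; case: (pe_eq0 he h).
Qed.

Lemma e_lead0 i j : has_lead0 (e i j).
Proof.
have [h|h] := boolP (j \in Y i); first by right; apply: e_lead.
by left=> eps he; case: (pe_eq0 he h).
Qed.

Lemma sum_p_neq eps i j : 0 < eps <= eps0 ->
  \sum_(k | k != i) p j k eps = 1 - p j i eps.
Proof. by move=> he; rewrite -((hsm he).2.1 j) [in RHS](bigD1 i) //= addrC addrK. Qed.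

Lemma exit_r : exists2 k, k != r & k \in Y r.
Proof. exact: exists_exit_r hA.2.2 N2. Qed.

Lemma subr_prr_gt0 eps : 0 < eps <= eps0 -> 0 < 1 - p r r eps.
Proof.
move=> he; have [k kr kY] := exit_r.
rewrite -sum_p_neq // (bigD1 k) //= ltr_pwDl ?(p_gt0 he) //.
by apply: sumr_ge0 => i _; apply: (hsm he).1.
Qed.

Lemma has_lead_subr_prr : has_lead (fun eps => 1 - p r r eps).
Proof.
have [k kr kY] := exit_r.
apply: (@has_lead_ext (fun eps => p r k eps + \sum_(j | (j != r) && (j != k)) p r j eps)).
  by move=> eps he; rewrite -sum_p_neq // [RHS](bigD1 k).
exact/has_leadDl/has_lead0_sum/p_lead0/p_lead.
Qed.

Lemma has_lead0_div_prr f : has_lead0 f -> has_lead0 (fun eps => f eps / (1 - p r r eps)).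
Proof. by move=> hf; apply: has_lead0M hf _; right; exact/has_leadV/has_lead_subr_prr. Qed.

Lemma has_lead_div_prr f : has_lead f -> has_lead (fun eps => f eps / (1 - p r r eps)).
Proof. by move=> hf; apply/has_leadM/has_leadV/has_lead_subr_prr. Qed.

Lemma rp_lead (i j : rX r) : j \in rY r Y i -> has_lead (rp r p i j).
Proof.
rewrite inE => /orP[h|/andP[h1 h2]].
  exact/has_leadDl/has_lead0M/has_lead0_div_prr/p_lead0/p_lead0/p_lead.
exact: has_leadDr (p_lead0 _ _) (has_leadM (p_lead h1) (has_lead_div_prr (p_lead h2))).
Qed.

Lemma re_lead (i j : rX r) : j \in rY r Y i -> has_lead (re r p e i j).
Proof.
have qj := has_lead0_div_prr (p_lead0 r (val j)).
have qi := has_lead0_div_prr (p_lead0 (val i) r).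
have t2 := has_lead0M (e_lead0 (val i) r) qj.
have t3 := has_lead0M (has_lead0M (e_lead0 r r) qi) qj.
have t4 := has_lead0M (e_lead0 r (val j)) qi.
rewrite inE => /orP[h|/andP[h1 h2]].
  exact: has_leadDl (has_leadDl (has_leadDl (e_lead h) t2) t3) t4.
have t2' := has_leadM (e_lead h1) (has_lead_div_prr (p_lead h2)).
exact: has_leadDl (has_leadDl (has_leadDr (e_lead0 _ _) t2') t3) t4.
Qed.

Lemma rp_ge0 eps (i j : rX r) : 0 < eps <= eps0 -> 0 <= rp r p i j eps.
Proof.
move=> he; have hp := (hsm he).1; have hq := ltW (subr_prr_gt0 he).
by rewrite addr_ge0 ?mulr_ge0 ?invr_ge0 ?hp.
Qed.

Lemma re_ge0 eps (i j : rX r) : 0 < eps <= eps0 -> 0 <= re r p e i j eps.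
Proof.
move=> he; have hp := (hsm he).1; have he0 := (hsm he).2.2.
have hq := ltW (subr_prr_gt0 he).
by rewrite !addr_ge0 ?mulr_ge0 ?invr_ge0 ?hp ?he0.
Qed.

Lemma rp_sum eps (i : rX r) : 0 < eps <= eps0 -> \sum_(j : rX r) rp r p i j eps = 1.
Proof.
move=> he; rewrite big_split /= -mulr_sumr -mulr_suml.
rewrite (sum_rX r (fun k => p (val i) k eps)) (sum_rX r (fun k => p r k eps)).
by rewrite !sum_p_neq // mulfV ?gt_eqF ?subr_prr_gt0 // mulr1 subrK.
Qed.

Lemma rp_le1 eps (i j : rX r) : 0 < eps <= eps0 -> rp r p i j eps <= 1.
Proof.
move=> he; rewrite -(rp_sum i he) (bigD1 j) //= lerDl.
by apply: sumr_ge0 => k _; apply: rp_ge0.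
Qed.

Lemma reduced_semiMarkov : semiMarkov_pe eps0 (rp r p) (re r p e).
Proof.
move=> eps he; split; first by move=> i j; apply: rp_ge0.
by split=> [i|i j]; [apply: rp_sum | apply: re_ge0].
Qed.

Lemma reduced_condA : condA eps0 (rp r p) (re r p e) (rY r Y).
Proof.
split; [|split].
- move=> i; have /existsP[k hk] := hA.1 (val i).
  have [v hv] : exists v : rX r, val v = k \/ (k = r /\ val v \in Y r).
    have [kr|kr] := eqVneq k r; last by exists (exist _ k kr); left.
    by have [k0 k0r k0Y] := exit_r; exists (exist _ k0 k0r); right.
  by apply/existsP; exists v; apply: mem_rY hk hv.
- move=> eps he; have hp := (hsm he).1; have hq := subr_prr_gt0 he; split.
    move=> i j; rewrite inE /rp => /orP[h|/andP[h1 h2]].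
      by rewrite ltr_wpDr ?(p_gt0 he) // !mulr_ge0 ?invr_ge0 ?hp // ltW.
    by rewrite ltr_wpDl ?hp // !mulr_gt0 ?invr_gt0 ?(p_gt0 he).
  move=> i j; rewrite inE negb_or negb_and /rp /re => /andP[h1 h2].
  have [-> ->] := pe_eq0 he h1.
  by case/orP: h2 => /(pe_eq0 he)[-> ->]; rewrite !(mul0r, mulr0, addr0).
- exact: (reach_rY (Y := Y) hA.2.2).
Qed.

Lemma reduced_condD : condD eps0 (rp r p) (rY r Y).
Proof.
move=> i j /rp_lead[m [c hm]].
have := lead_exp_exponent_ge0 hm (fun eps he => rp_le1 i j he).
case: m hm => [k|//] hm _; have [G [e1 hk]] := expD_of_lead_exp hm.
by exists k, k, (fun _ => c), d, G, e1.
Qed.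

Lemma reduced_condE : condE_ge eps0 (re r p e) (rY r Y) d.
Proof.
move=> i j /re_lead[m [c hm]]; have [G [e1 hm']] := expE_of_lead_exp hm.
by exists m, m, (fun _ => c), d, G, e1.
Qed.

End Reduction.

End LeadingTerm.

Lemma deltastar_le (R : realType) (N : nat) (Y : 'I_N -> {set 'I_N})
    (dl dd : 'I_N -> 'I_N -> R) i j :
  j \in Y i -> deltastar Y dl dd <= Num.min (dl i j) (dd i j).
Proof. by move=> h; apply: le_trans (bigmin_le _ i _) (bigmin_le_cond _ _ h). Qed.

Lemma deltastar_gt0 (R : realType) (N : nat) (Y : 'I_N -> {set 'I_N})
    (dl dd : 'I_N -> 'I_N -> R) :
  (forall i j, j \in Y i -> 0 < dl i j /\ 0 < dd i j) -> 0 < deltastar Y dl dd.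
Proof.
move=> h; apply: lt_bigmin => // i _; apply: lt_bigmin => // j /h[].
by rewrite lt_min => -> ->.
Qed.

Theorem theorem2 (R : realType) (N : nat) (eps0 : R)
    (p e : 'I_N -> 'I_N -> R -> R) (Y : 'I_N -> {set 'I_N})
    (lm lp : 'I_N -> 'I_N -> nat) (a : 'I_N -> 'I_N -> nat -> R)
    (dl G el : 'I_N -> 'I_N -> R)
    (mm mp : 'I_N -> 'I_N -> int) (b : 'I_N -> 'I_N -> int -> R)
    (dd Gd ed : 'I_N -> 'I_N -> R) :
  (2 <= N)%N ->
  0 < eps0 <= 1 ->
  semiMarkov_pe eps0 p e ->
  condA eps0 p e Y ->
  (forall i j, j \in Y i ->
     expD eps0 (p i j) (lm i j) (lp i j) (a i j) (dl i j) (G i j) (el i j)) ->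
  (forall i j, j \in Y i ->
     expE eps0 (e i j) (mm i j) (mp i j) (b i j) (dd i j) (Gd i j) (ed i j)) ->
  forall r : 'I_N,
    [/\ semiMarkov_pe eps0 (rp r p) (re r p e),
        condA eps0 (rp r p) (re r p e) (rY r Y),
        condD eps0 (rp r p) (rY r Y) &
        condE_ge eps0 (re r p e) (rY r Y) (deltastar Y dl dd)].
Proof.
move=> N2 eps0P hsm hA hD hE r; set ds := deltastar Y dl dd.
have ds_le i j : j \in Y i -> ds <= dl i j /\ ds <= dd i j.
  by move=> /(deltastar_le dl dd); rewrite le_min => /andP.
have dsP : 0 < ds <= 1.
  rewrite deltastar_gt0 ?bigmin_le_id // => i j h.
  by case: (hD i j h) (hE i j h) => _ _ /andP[-> _] _ _ [_ _ /andP[-> _] _ _].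
have p_lead i j : j \in Y i -> has_lead eps0 ds (p i j).
  by move=> h; apply: (has_lead_of_expD eps0P dsP (ds_le i j h).1 (hD i j h)).
have e_lead i j : j \in Y i -> has_lead eps0 ds (e i j).
  by move=> h; apply: (has_lead_of_expE eps0P dsP (ds_le i j h).2 (hE i j h)).
split; first exact: reduced_semiMarkov r N2 hsm hA.
- exact: reduced_condA N2 hsm hA.
- exact: (reduced_condD eps0P dsP (r := r) N2 hsm hA p_lead).
- exact: (reduced_condE eps0P dsP (r := r) N2 hsm hA p_lead e_lead).
Qed.
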